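(* Let $(X,d)$ be a complete separable metric space and $(\xi_k)_{k=1}^n$ a stochastic process with state space $X$, initial law $P^{(1)}$ and conditional laws $p_k(\cdot\mid x^{(k-1)})$. Suppose there exist $\kappa_1>0$, $M>0$ and $0\le\rho_j\le M$ ($j=1,\dots,n$) such that: (i) $P^{(1)}$ and $p_k(\cdot\mid x^{(k-1)})$ ($k=2,\dots,n$, $x^{(k-1)}\in X^{k-1}$) satisfy $GC(\kappa_1)$ on $(X,d)$; (ii) for $k=2,\dots,n$ and all $x^{(k-1)},y^{(k-1)}$: $W_1\bigl(p_k(\cdot\mid x^{(k-1)}),p_k(\cdot\mid y^{(k-1)})\bigr)\le\sum_{j=1}^{k-1}\rho_{k-j}\,d(x_j,y_j)$. Then $P^{(n)}$ satisfies $GC(\kappa_n)$ on $(X^n,d^{(1)})$ with $\kappa_n=\kappa_1(1+M)^{2n}/M^2$. If moreover (iii) $\sum_{j=1}^n\rho_j\le R$, then $P^{(n)}$ satisfies $GC(\kappa_n(R))$ on $(X^n,d^{(1)})$ with $$\kappa_n(R)=\kappa_1\sum_{m=1}^n\Bigl(\sum_{k=0}^{m-1}R^k\Bigr)^2.$$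
   Context: $GC(\kappa)$ for $\mu$ on a metric space $(Y,\delta)$: $\int e^{tF}d\mu\le\exp(t\int Fd\mu+\kappa t^2/2)$ for all $t\in\mathbb R$ and all $1$-Lipschitz $F:(Y,\delta)\to\mathbb R$. $W_1(\mu,\nu)=\inf_\pi\iint d(x,y)\pi(dx\,dy)$ over couplings. $d^{(1)}(x^{(n)},y^{(n)})=\sum_{j=1}^nd(x_j,y_j)$. Joint law $P^{(n)}(dx^{(n)})=p_n(dx_n\mid x^{(n-1)})\cdots p_2(dx_2\mid x_1)P^{(1)}(dx_1)$. *)

(* Defs.v *)
From HB Require Import structures.
From mathcomp Require Import all_boot all_order all_algebra.
From mathcomp Require Import all_classical all_reals all_analysis.
Set Implicit Arguments. Unset Strict Implicit. Unset Printing Implicit Defensive.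
Import Order.TTheory GRing.Theory Num.Theory.
Local Open Scope classical_set_scope.
Local Open Scope ring_scope.

Section defs.
Context (R : realType).

Definition is_metric (X : Type) (d : X -> X -> R) : Prop :=
  [/\ forall x y, d x y = 0 <-> x = y,
      forall x y, d x y = d y x &
      forall x y z, d x z <= d x y + d y z].

Definition d_complete (X : Type) (d : X -> X -> R) : Prop :=
  forall u : nat -> X,
    (forall e, 0 < e -> exists N, forall m k, (N <= m)%N -> (N <= k)%N -> d (u m) (u k) < e) ->
    exists l, forall e, 0 < e -> exists N, forall m, (N <= m)%N -> d (u m) l < e.

Definition d_separable (X : Type) (d : X -> X -> R) : Prop :=
  exists D : set X, countable D /\
    forall x e, 0 < e -> exists2 y, D y & d x y < e.

Definition d_open (X : Type) (d : X -> X -> R) : set (set X) :=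
  [set U | forall x, U x -> exists2 r, 0 < r & [set y | d x y < r] `<=` U].

Definition d_borel d0 (X : measurableType d0) (d : X -> X -> R) : Prop :=
  @measurable d0 X = <<s d_open d >>.

Definition GC d0 (Y : measurableType d0) (delta : Y -> Y -> R)
    (mu : {measure set Y -> \bar R}) (kappa : R) : Prop :=
  forall F : Y -> R, measurable_fun setT F ->
    (forall x y, `|F x - F y| <= delta x y) ->
    mu.-integrable setT (EFin \o F) /\
    forall t : R,
      (\int[mu]_x (expR (t * F x))%:E <=
       (expR (t * Rintegral mu setT F + kappa * t ^+ 2 / 2))%:E)%E.

Definition coupling d0 (X : measurableType d0)
    (mu nu : {measure set X -> \bar R}) (pi : probability (X * X)%type R) : Prop :=
  forall A : set X, measurable A ->
    pi (A `*` setT) = mu A /\ pi (setT `*` A) = nu A.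

Definition W1 d0 (X : measurableType d0) (d : X -> X -> R)
    (mu nu : {measure set X -> \bar R}) : \bar R :=
  ereal_inf [set (\int[pi]_z (d z.1 z.2)%:E)%E
            | pi in [set pi | coupling mu nu pi]].

Definition dist1 (X : Type) (d : X -> X -> R) (n : nat)
    (x y : n.-tuple X) : R :=
  \sum_(i < n) d (tnth x i) (tnth y i).

(** Iterated integral  int P1(dx_1) int p(dx_2|x_1) ... int p(dx_{h+m}|x^{(h+m-1)}) f(x)
    starting from the history h; [p k] is the law of the (k+1)-th coordinate given
    the first k coordinates (k >= 1), and [P1] the law of the first coordinate. *)
Fixpoint iter_int d0 (X : measurableType d0)
    (P1 : probability X R) (p : forall k : nat, R.-pker (k.-tuple X) ~> X)
    (m : nat) (h : seq X) (f : seq X -> \bar R) : \bar R :=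
  match m with
  | 0 => f h
  | m'.+1 =>
      if h is [::] then (\int[P1]_y iter_int P1 p m' [:: y] f)%E
      else (\int[p (size h) (in_tuple h)]_y iter_int P1 p m' (rcons h y) f)%E
  end.

Definition joint_law d0 (X : measurableType d0)
    (P1 : probability X R) (p : forall k : nat, R.-pker (k.-tuple X) ~> X)
    (n : nat) (P : probability (n.-tuple X) R) : Prop :=
  forall A : set (n.-tuple X), measurable A ->
    P A = iter_int P1 p n [::]
            (fun s => if insub s is Some t then (\1_A t)%:E else 0%E).

End defs.

(* Main.v *)
(* Averaging a function of k+1 coordinates over the last one, under its
   conditional law, turns sensitivities (a_0, ..., a_k) into
   a_i + a_k rho_(k-i), by the easy half of Kantorovich duality; and GC for the
   conditional law bounds the exponential moment by that of the average, up to
   the factor exp (kappa1 a_k^2 t^2 / 2).  Integrating the coordinates out one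
   after the other, the variance proxy is kappa1 times the sum of the squares of
   the successive last sensitivities.  Starting from a = 1, a Gronwall-type
   induction bounds the m-th of them by (1 + M)^(m-1), or by
   1 + R + ... + R^(m-1) under (iii). *)
Require Import Defs.
From HB Require Import structures.
From mathcomp Require Import all_boot all_order all_algebra.
From mathcomp Require Import all_classical all_reals all_analysis.
From mathcomp Require Import measurable_realfun ring lra zify.
Import Order.TTheory GRing.Theory Num.Theory.
Local Open Scope classical_set_scope.
Local Open Scope ring_scope.

(** * Lipschitz functions under [GC] and under transport *)

(** Rescaling: [GC] is applied to [F / c] at the parameter [t * c]. *)
Lemma GC_lipschitz (R : realType) d0 (Y : measurableType d0)
    (delta : Y -> Y -> R) (mu : {measure set Y -> \bar R}) (kappa c : R)
    (F : Y -> R) :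
  GC delta mu kappa -> 0 < c -> measurable_fun setT F ->
  (forall x y, `|F x - F y| <= c * delta x y) ->
  mu.-integrable setT (EFin \o F) /\
  forall t : R, (\int[mu]_x (expR (t * F x))%:E <=
    (expR (t * Rintegral mu setT F + kappa * c ^+ 2 * t ^+ 2 / 2))%:E)%E.
Proof.
move=> gc c0 mF lF.
have cN0 : c != 0 by rewrite gt_eqF.
pose G y := c^-1 * F y.
have mG : measurable_fun setT G by exact: measurable_funM.
have FE y : F y = c * G y by rewrite /G mulrA mulfV// mul1r.
have [y1 y2|iG eG] := gc G mG.
  by rewrite /G -mulrBr normrM gtr0_norm ?invr_gt0// mulrC ler_pdivrMr// mulrC.
have iF : mu.-integrable setT (EFin \o F).
  rewrite (_ : EFin \o F = fun y => (c%:E * (EFin \o G) y)%E).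
    exact: integrableZl.
  by apply/funext => y /=; rewrite FE EFinM.
split=> // t.
have -> : Rintegral mu setT F = c * Rintegral mu setT G.
  rewrite -RintegralZl//; apply: eq_Rintegral => y _; exact: FE.
have := eG (t * c).
rewrite (_ : t * c * _ + kappa * (t * c) ^+ 2 / 2 =
             t * (c * Rintegral mu setT G) + kappa * c ^+ 2 * t ^+ 2 / 2).
  by under eq_integral => y _ do rewrite -mulrA -FE.
by ring.
Qed.

(* No measurability is assumed, so that the cost [d z.1 z.2] in [W1] can be
   handled without proving [d] measurable on the product. *)
Lemma ge0_le_integral_pointwise (R : realType) d0 (Y : measurableType d0)
    (mu : {measure set Y -> \bar R}) (f g : Y -> \bar R) :
  (forall y, 0 <= f y)%E -> (forall y, f y <= g y)%E ->
  (\int[mu]_y f y <= \int[mu]_y g y)%E.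
Proof.
move=> f0 fg; have g0 y : (0 <= g y)%E := le_trans (f0 y) (fg y).
rewrite !ge0_integralTE//; apply: ge_ereal_sup => _ [h hf <-].
by apply: ereal_sup_ubound; exists h => // y; exact: le_trans (hf y) (fg y).
Qed.

Lemma Rintegral_marginal (R : realType) d0 d1 (X : measurableType d0)
    (Y : measurableType d1) (pi : {measure set Y -> \bar R}) (phi : Y -> X)
    (mu : {measure set X -> \bar R}) (g : X -> R) :
  measurable_fun setT phi -> measurable_fun setT g ->
  (forall A, measurable A -> pi (phi @^-1` A) = mu A) ->
  mu.-integrable setT (EFin \o g) ->
  pi.-integrable setT (EFin \o (g \o phi)) /\
  Rintegral pi setT (g \o phi) = Rintegral mu setT g.
Proof.
move=> mphi mg marg ig.
have ext (h : X -> \bar R) :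
    (\int[pushforward pi phi]_x h x = \int[mu]_x h x)%E.
  by apply: eq_measure_integral => A mA _; exact: marg.
have igphi : pi.-integrable setT (EFin \o (g \o phi)).
  apply/integrableP; split.
    by apply/measurable_EFinP; exact: measurableT_comp.
  have /integrableP[_] := ig; rewrite -ext ge0_integral_pushforward//.
  by apply/measurable_EFinP; exact: measurableT_comp.
split=> //; rewrite /Rintegral -ext integral_pushforward//.
by apply/measurable_EFinP.
Qed.

(** Easy half of Kantorovich duality: under any coupling the difference of the means is the integral
    of [g x - g y], at most [c] times the transport cost. *)
Lemma W1_lipschitz (R : realType) d0 (X : measurableType d0) (d : X -> X -> R)
    (mu nu : {measure set X -> \bar R}) (c r : R) (g : X -> R) :
  0 < c -> measurable_fun setT g ->
  (forall x y, `|g x - g y| <= c * d x y) ->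
  mu.-integrable setT (EFin \o g) -> nu.-integrable setT (EFin \o g) ->
  (W1 d mu nu <= r%:E)%E ->
  `|Rintegral mu setT g - Rintegral nu setT g| <= c * r.
Proof.
move=> c0 mg lg imu inu W.
(* Dividing by [c] leaves a lower bound to prove for the cost of each coupling. *)
rewrite mulrC -ler_pdivrMr// -lee_fin; apply: le_trans W.
apply/le_ereal_inf_tmp => _ [pi cpl <-].
have [] := @Rintegral_marginal R _ _ X _ pi fst mu g _ _ _ imu => //.
  by move=> A mA; have [<- _] := cpl A mA; rewrite setXT.
move=> i1 <-.
have [] := @Rintegral_marginal R _ _ X _ pi snd nu g _ _ _ inu => //.
  by move=> A mA; have [_ <-] := cpl A mA; rewrite setTX.
move=> i2 <-.
rewrite -RintegralB//.
have iB : pi.-integrable setT (EFin \o ((g \o fst) \- (g \o snd))).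
  rewrite (_ : _ \o _ = ((EFin \o (g \o fst)) \- (EFin \o (g \o snd)))%E)//.
  exact: integrableB.
apply: (@le_trans _ _ (c^-1%:E * (\int[pi]_x (`|g x.1 - g x.2|%R)%:E))%E).
  rewrite mulrC EFinM lee_pmul2l ?lte_fin ?invr_gt0//.
  have := le_normr_Rintegral measurableT iB; rewrite -lee_fin => /le_trans; apply.
  rewrite /Rintegral fineK//.
  exact/integrable_fin_num/integrable_norm.
rewrite -ge0_integralZl//; last 2 first.
- apply/measurable_EFinP/measurableT_comp => //.
  by apply/measurable_EFinP; exact: measurable_int iB.
- by rewrite lee_fin invr_ge0 ltW.
apply: ge0_le_integral_pointwise => z.
  by rewrite -EFinM lee_fin mulr_ge0// invr_ge0 ltW.
by rewrite -EFinM lee_fin mulrC ler_pdivrMr// mulrC.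
Qed.

(** * Appending a coordinate and composing kernels *)

Lemma tnth_rcons_widen (T : Type) k (x : k.-tuple T) (y : T) (i : 'I_k) :
  tnth [tuple of rcons x y] (widen_ord (leqnSn k) i) = tnth x i.
Proof. by rewrite !(tnth_nth y)/= nth_rcons size_tuple ltn_ord. Qed.

Lemma tnth_rcons_max (T : Type) k (x : k.-tuple T) (y : T) :
  tnth [tuple of rcons x y] ord_max = y.
Proof. by rewrite (tnth_nth y)/= nth_rcons size_tuple ltnn eqxx. Qed.

Lemma measurable_rcons d0 (X : measurableType d0) k :
  measurable_fun setT
    (fun z : k.-tuple X * X => [tuple of rcons z.1 z.2] : k.+1.-tuple X).
Proof.
apply/measurable_fun_tnthP => i.
have [ik|ki] := ltnP i k; last first.
  rewrite (_ : _ \o _ = snd)//; apply/funext => -[x y] /=.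
  rewrite (_ : i = ord_max) ?tnth_rcons_max//.
  by apply/val_inj/eqP; rewrite eqn_leq ki -ltnS ltn_ord.
rewrite (_ : _ \o _ = (fun x => tnth x (Ordinal ik)) \o fst).
  by apply: measurableT_comp => //; exact: measurable_tnth.
apply/funext => -[x y] /=; rewrite -(tnth_rcons_widen _ _ x y).
by congr tnth; exact: val_inj.
Qed.

Section extension.
Context (R : realType) d0 (X : measurableType d0) (k : nat).
Context (q : R.-pker (k.-tuple X) ~> X).

Let mrcons (x : k.-tuple X) :
  measurable_fun setT (fun y => [tuple of rcons x y] : k.+1.-tuple X).
Proof. exact: measurableT_comp (@measurable_rcons _ X k) (measurable_pair1 x). Qed.

(** The factor [unit] is there because [\;] passes to its second kernel the source point together
    with the intermediate one. *)
Definition extend (z : unit * k.-tuple X) : {measure set (k.+1.-tuple X) -> \bar R}.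
Proof.
by refine (pushforward (q z.2) (fun y => [tuple of rcons z.2 y])); exact: mrcons.
Defined.

Let measurable_extend U : measurable U -> measurable_fun setT (extend ^~ U).
Proof.
move=> mU.
(* The mass of [U] is the [q]-mass of the section of [V] at the history, which is measurable in the
   history. *)
pose V := (fun w : k.-tuple X * X => [tuple of rcons w.1 w.2]) @^-1` U.
have mV : measurable V by rewrite -[V]setTI; exact: measurable_rcons.
have := @measurable_fun_xsection_finite_kernel _ _ _ _ _ q V.
rewrite inE => /(_ mV) mq.
rewrite (_ : extend ^~ U = (fun x => q x (xsection V x)) \o snd).
  exact: measurableT_comp.
by apply/funext => -[u x]; rewrite /= xsectionE.
Qed.

HB.instance Definition _ := isKernel.Build _ _ _ _ _ extend measurable_extend.

Let prob_extend z : extend z setT = 1%E.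
Proof. by rewrite /extend/= /pushforward preimage_setT prob_kernel. Qed.

HB.instance Definition _ := Kernel_isProbability.Build _ _ _ _ _ extend prob_extend.

End extension.
Arguments extend {R d0 X k} q.

(* [unit] is a dummy source, so that the joint law of the first [k] coordinates
   can be built by kernel composition. *)
Fixpoint chain {R : realType} {d0} {X : measurableType d0}
    (q : forall k, R.-pker (k.-tuple X) ~> X) (k : nat) :
    R.-sfker unit ~> (k.-tuple X) :=
  match k with
  | 0 => kdirac (measurable_cst [tuple])
  | k'.+1 => (chain q k' \; extend (q k'))%E
  end.

Lemma ge0_integral_chain (R : realType) d0 (X : measurableType d0)
    (q : forall k, R.-pker (k.-tuple X) ~> X) (k : nat)
    (f : k.+1.-tuple X -> \bar R) :
  (forall x, 0 <= f x)%E -> measurable_fun setT f ->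
  (\int[chain q k.+1 tt]_x f x =
   \int[chain q k tt]_x \int[q k x]_y f [tuple of rcons x y])%E.
Proof.
move=> f0 mf; rewrite [LHS]integral_kcomp//; apply: eq_integral => x _.
rewrite ge0_integral_pushforward//.
exact: measurableT_comp (@measurable_rcons _ X k) (measurable_pair1 x).
Qed.

Lemma measurable_integral_rcons (R : realType) d0 (X : measurableType d0) (k : nat)
    (q : R.-pker (k.-tuple X) ~> X) (f : k.+1.-tuple X -> \bar R) :
  (forall x, 0 <= f x)%E -> measurable_fun setT f ->
  measurable_fun setT (fun x => \int[q x]_y f [tuple of rcons x y])%E.
Proof.
move=> f0 mf; pose h (z : k.-tuple X * X) := f [tuple of rcons z.1 z.2].
have mh : measurable_fun setT h.
  exact: measurableT_comp mf (@measurable_rcons _ X k).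
exact: (measurable_fun_integral_finite_kernel h q (fun z => f0 _) mh).
Qed.

(** * The joint law as a composed kernel *)

(** Reads the initial law as a kernel from the empty history, so that all steps of the process have
    one form. *)
Definition law_step {R : realType} {d0} {X : measurableType d0}
    (P1 : probability X R) (p : forall k : nat, R.-pker (k.-tuple X) ~> X)
    (k : nat) : R.-pker (k.-tuple X) ~> X :=
  if k is k'.+1 then p k'.+1
  else kprobability (measurable_cst (P1 : pprobability X R)).

Lemma iter_intS (R : realType) d0 (X : measurableType d0)
    (P1 : probability X R) (p : forall k : nat, R.-pker (k.-tuple X) ~> X)
    m k (x : k.-tuple X) (f : seq X -> \bar R) :
  (iter_int P1 p m.+1 x f =
   \int[law_step P1 p k x]_y iter_int P1 p m [tuple of rcons x y] f)%E.
Proof.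
case: x => s sk /=; move: (eqP sk) => ks; subst k.
rewrite (_ : Tuple sk = in_tuple s); last exact: val_inj.
by case: s sk.
Qed.

Lemma iter_int_ge0 (R : realType) d0 (X : measurableType d0)
    (P1 : probability X R) (p : forall k : nat, R.-pker (k.-tuple X) ~> X)
    m s (f : seq X -> \bar R) :
  (forall s, 0 <= f s)%E -> (0 <= iter_int P1 p m s f)%E.
Proof.
by move=> f0; elim: m s => //= m IH [|x s]; apply: integral_ge0.
Qed.

(** The first [k] integrations are done by [chain], the other [m] by [iter_int]. Each induction step
    moves one across; this takes a measurable integrand, hence the first conclusion. *)
Lemma integral_iter_int (R : realType) d0 (X : measurableType d0)
    (P1 : probability X R) (p : forall k : nat, R.-pker (k.-tuple X) ~> X)
    n (f : seq X -> \bar R) m k :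
  (forall s, 0 <= f s)%E -> measurable_fun setT (fun x : n.-tuple X => f x) ->
  (k + m = n)%N ->
  measurable_fun setT (fun x : k.-tuple X => iter_int P1 p m x f) /\
  (\int[chain (law_step P1 p) k tt]_x iter_int P1 p m x f =
   \int[chain (law_step P1 p) n tt]_x f x)%E.
Proof.
move=> f0 mf; elim: m k => [k|m IH k].
  by rewrite addn0 => ->.
rewrite addnS -addSn => /IH[mI <-].
have I0 x : (0 <= iter_int P1 p m x f)%E := iter_int_ge0 _ _ _ _ _ _ _ _ f0.
split.
  under eq_fun do rewrite iter_intS.
  exact: (@measurable_integral_rcons _ _ _ _ _ (fun x => iter_int P1 p m x f)).
by rewrite ge0_integral_chain//; apply: eq_integral => x _; rewrite iter_intS.
Qed.

Lemma joint_lawE (R : realType) d0 (X : measurableType d0)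
    (P1 : probability X R) (p : forall k : nat, R.-pker (k.-tuple X) ~> X)
    n (P : probability (n.-tuple X) R) (A : set (n.-tuple X)) :
  joint_law P1 p P -> measurable A -> P A = chain (law_step P1 p) n tt A.
Proof.
move=> jl mA; rewrite jl//; set f := (f in iter_int _ _ _ _ f).
have fE (x : n.-tuple X) : f x = (\1_A x)%:E by rewrite /f valK.
have [||mI] := @integral_iter_int R d0 X P1 p n f n 0 _ _ (add0n n).
- by move=> s; rewrite /f; case: insub.
- by under eq_fun do rewrite fE; exact/measurable_EFinP.
(* At [k = 0] the chain is the Dirac mass at the empty tuple. *)
rewrite integral_dirac// diracT mul1e => ->.
under eq_integral do rewrite fE.
by rewrite integral_indic// setIT.
Qed.

(** * Averaging over the last coordinate *)

Definition rcons_mean {R : realType} {d0} {X : measurableType d0} {k : nat}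
    (q : R.-pker (k.-tuple X) ~> X) (F : k.+1.-tuple X -> R) (x : k.-tuple X) : R :=
  Rintegral (q x) setT (fun y => F [tuple of rcons x y]).

(** By definition of the integral, the mean is [fine] of a difference of two nonnegative integrals,
    each measurable in the history. *)
Lemma measurable_rcons_mean (R : realType) d0 (X : measurableType d0) (k : nat)
    (q : R.-pker (k.-tuple X) ~> X) (F : k.+1.-tuple X -> R) :
  measurable_fun setT F -> measurable_fun setT (rcons_mean q F).
Proof.
move=> mF; have mEF : measurable_fun setT (EFin \o F) by exact/measurable_EFinP.
rewrite (_ : rcons_mean q F = fine \o
    (fun x => \int[q x]_y (EFin \o F)^\+ [tuple of rcons x y] -
              \int[q x]_y (EFin \o F)^\- [tuple of rcons x y])%E).
  apply: measurableT_comp => //; apply: emeasurable_funB;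
    apply: measurable_integral_rcons => //.
  - exact: measurable_funepos.
  - exact: measurable_funeneg.
apply/funext => x; rewrite /rcons_mean /Rintegral integralE/=.
by congr (fine (_ - _)); apply: eq_integral => y _; rewrite /= ?(funeposE, funenegE).
Qed.

(** Fubini, from Tonelli applied to the positive and negative parts of [F]. *)
Lemma integral_chain (R : realType) d0 (X : measurableType d0)
    (q : forall k, R.-pker (k.-tuple X) ~> X) (k : nat) (F : k.+1.-tuple X -> R) :
  (chain q k.+1 tt).-integrable setT (EFin \o F) ->
  (forall x, (q k x).-integrable setT
    (EFin \o (fun y => F [tuple of rcons x y]))) ->
  (\int[chain q k.+1 tt]_x (F x)%:E =
   \int[chain q k tt]_x (rcons_mean (q k) F x)%:E)%E.
Proof.
move=> iF iFx.
have mF : measurable_fun setT (EFin \o F) := measurable_int _ iF.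
have mP := measurable_funepos mF; have mN := measurable_funeneg mF.
rewrite integralE !ge0_integral_chain//.
have iP := integrable_funepos measurableT iF.
have iN := integrable_funeneg measurableT iF.
have part (f : k.+1.-tuple X -> \bar R) : (forall x, 0 <= f x)%E ->
    (chain q k.+1 tt).-integrable setT f ->
    (chain q k tt).-integrable setT
      (fun x => \int[q k x]_y f [tuple of rcons x y])%E.
  move=> f0 /integrableP[mf]; under eq_integral do rewrite gee0_abs//.
  rewrite ge0_integral_chain// => fi; apply/integrableP; split.
    exact: measurable_integral_rcons.
  by under eq_integral do rewrite gee0_abs ?integral_ge0//.
rewrite -integralB//; [|exact: part..].
apply: eq_integral => x _; rewrite /rcons_mean /Rintegral fineK.
  rewrite [RHS]integralE; congr (_ - _)%E; apply: eq_integral => y _ /=.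
    by rewrite !funeposE.
  by rewrite !funenegE.
exact: integrable_fin_num.
Qed.

(** * Sensitivities and exponential moments *)

(** With weights [rho (k - i)] this is the right-hand side of (ii); as a bound on [F], [a i] is a
    Lipschitz constant in coordinate [i]. *)
Definition wdist {R : realType} {X : Type} (d : X -> X -> R) (a : nat -> R) {k : nat}
    (x y : k.-tuple X) : R :=
  \sum_(i < k) a i * d (tnth x i) (tnth y i).

Lemma wdist_rcons (R : realType) (X : Type) (d : X -> X -> R) a k
    (x y : k.-tuple X) u v :
  wdist d a [tuple of rcons x u] [tuple of rcons y v] = wdist d a x y + a k * d u v.
Proof.
rewrite /wdist big_ord_recr /= !tnth_rcons_max; congr (_ + _).
by apply: eq_bigr => i _; rewrite !tnth_rcons_widen.
Qed.

(** Sensitivity to coordinate [i] once coordinate [k] is averaged out: the direct one, plus the one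
    passed on through the law of coordinate [k]. *)
Definition push_weights {R : realType} (rho : nat -> R) (k : nat) (a : nat -> R)
    (i : nat) : R :=
  a i + a k * rho (k - i)%N.

(** Variance proxy, up to [kappa], of averaging out the coordinates [k - 1, ..., 0] in turn. *)
Fixpoint weight_cost {R : realType} (rho : nat -> R) (k : nat) (a : nat -> R) : R :=
  if k is k'.+1 then a k' ^+ 2 + weight_cost rho k' (push_weights rho k' a) else 0.

(** The transport hypothesis has the dual form of [W1_lipschitz], so that it also covers the initial
    law, for which it is trivial. *)
Lemma rcons_mean_lipschitz (R : realType) d0 (X : measurableType d0)
    (d : X -> X -> R) (k : nat) (q : R.-pker (k.-tuple X) ~> X)
    (rho : nat -> R) (a : nat -> R) (F : k.+1.-tuple X -> R) :
  is_metric d ->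
  (forall (x y : k.-tuple X) (c : R) (g : X -> R), 0 < c -> measurable_fun setT g ->
     (forall u v, `|g u - g v| <= c * d u v) ->
     `|Rintegral (q x) setT g - Rintegral (q y) setT g| <=
       c * wdist d (fun i => rho (k - i)%N) x y) ->
  0 < a k -> measurable_fun setT F ->
  (forall x y : k.-tuple X, (q x).-integrable setT
    (EFin \o (fun u => F [tuple of rcons y u]))) ->
  (forall x y, `|F x - F y| <= wdist d a x y) ->
  forall x y, `|rcons_mean q F x - rcons_mean q F y| <=
    wdist d (push_weights rho k a) x y.
Proof.
move=> md hW ak mF iF lF x y; have [d_0 _ _] := md.
have dxx u : d u u = 0 by exact/d_0.
have wxx (z : k.-tuple X) : wdist d a z z = 0.
  by rewrite /wdist big1// => i _; rewrite dxx mulr0.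
have mFx (z : k.-tuple X) : measurable_fun setT (fun u => F [tuple of rcons z u]).
  apply: measurableT_comp mF _.
  exact: measurableT_comp (@measurable_rcons _ X k) (measurable_pair1 z).
have -> : wdist d (push_weights rho k a) x y =
    a k * wdist d (fun i => rho (k - i)%N) x y + wdist d a x y.
  rewrite /wdist mulr_sumr -big_split/=; apply: eq_bigr => i _.
  by rewrite /push_weights; ring.
(* The intermediate mean keeps [x] inside [F] but uses the law [q y]. The first gap changes only the
   law, at the cost of [a k] times the transport bound; the second changes only the history, at the
   pointwise cost [wdist d a x y]. *)
rewrite (le_trans (ler_distD (Rintegral (q y) setT (fun u => F [tuple of rcons x u])) _ _))//.
apply: lerD.
  apply: hW => // u v.
  by have := lF [tuple of rcons x u] [tuple of rcons x v]; rewrite wdist_rcons wxx add0r.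
have iyx := iF y x; have iyy := iF y y.
rewrite /rcons_mean -RintegralB//.
set D := fun u => _.
have iD : (q y).-integrable setT (EFin \o D).
  rewrite (_ : _ \o _ = ((EFin \o (fun u => F [tuple of rcons x u])) \-
                       (EFin \o (fun u => F [tuple of rcons y u])))%E)//.
  exact: integrableB.
apply: (le_trans (le_normr_Rintegral measurableT iD)).
have <- : Rintegral (q y) setT (cst (wdist d a x y)) = wdist d a x y.
  by rewrite Rintegral_cst// prob_kernel mulr1.
apply: le_Rintegral => //.
- exact: integrable_norm.
- apply/integrableP; split; first exact: measurable_cst.
  by rewrite integral_cst// prob_kernel mule1 ltry.
- move=> u _; rewrite /D/=.
  by have := lF [tuple of rcons x u] [tuple of rcons y u]; rewrite wdist_rcons dxx mulr0 addr0.
Qed.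

(** Induction on [k] for all [a] and [F] at once, since averaging changes both. The weights stay
    positive because [GC_lipschitz] divides by the last one. *)
Lemma chain_concentration (R : realType) d0 (X : measurableType d0)
    (d : X -> X -> R) (q : forall k, R.-pker (k.-tuple X) ~> X)
    (n : nat) (kappa : R) (rho : nat -> R) :
  is_metric d ->
  (forall k, (k < n)%N -> forall x, GC d (q k x) kappa) ->
  (forall k, (k < n)%N -> forall (x y : k.-tuple X) (c : R) (g : X -> R),
     0 < c -> measurable_fun setT g ->
     (forall u v, `|g u - g v| <= c * d u v) ->
     `|Rintegral (q k x) setT g - Rintegral (q k y) setT g| <=
       c * wdist d (fun i => rho (k - i)%N) x y) ->
  (forall j, (0 < j <= n)%N -> 0 <= rho j) ->
  forall k (a : nat -> R) (F : k.-tuple X -> R), (k <= n)%N ->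
  (forall i, (i < k)%N -> 0 < a i) ->
  measurable_fun setT F ->
  (forall x y, `|F x - F y| <= wdist d a x y) ->
  (chain q k tt).-integrable setT (EFin \o F) /\
  forall t : R, (\int[chain q k tt]_x (expR (t * F x))%:E <=
    (expR (t * Rintegral (chain q k tt) setT F +
           kappa * weight_cost rho k a * t ^+ 2 / 2))%:E)%E.
Proof.
move=> md gc hW rho0; elim=> [|k IH] a F kn a0 mF lF.
  have mEF : measurable_fun setT (EFin \o F) by exact/measurable_EFinP.
  split.
    apply/integrableP; split=> //.
    by rewrite integral_dirac ?diracT ?mul1e ?ltry//; exact: measurableT_comp.
  move=> t; rewrite integral_dirac//; last first.
    apply/measurable_EFinP; apply: measurableT_comp => //.
    exact: measurable_funM.
  rewrite diracT mul1e /Rintegral integral_dirac// diracT mul1e.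
  by rewrite mulr0 mul0r mul0r addr0.
have ak : 0 < a k by exact: a0.
have [d_0 _ _] := md.
have dxx u : d u u = 0 by exact/d_0.
have wxx (z : k.-tuple X) : wdist d a z z = 0.
  by rewrite /wdist big1// => i _; rewrite dxx mulr0.
have msl (H : k.+1.-tuple X -> R) (z : k.-tuple X) : measurable_fun setT H ->
    measurable_fun setT (fun u => H [tuple of rcons z u]).
  move=> mH; apply: measurableT_comp mH _.
  exact: measurableT_comp (@measurable_rcons _ X k) (measurable_pair1 z).
(* The histories [x] and [z] are independent because [rcons_mean_lipschitz] mixes them; [H] will be
   both [F] and its absolute value. *)
have slice (H : k.+1.-tuple X -> R) (x z : k.-tuple X) : measurable_fun setT H ->
    (forall x y, `|H x - H y| <= wdist d a x y) ->
    (q k x).-integrable setT (EFin \o (fun u => H [tuple of rcons z u])) /\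
    forall t : R, (\int[q k x]_u (expR (t * H [tuple of rcons z u]))%:E <=
      (expR (t * Rintegral (q k x) setT (fun u => H [tuple of rcons z u]) +
       kappa * a k ^+ 2 * t ^+ 2 / 2))%:E)%E.
  move=> mH lH; apply: (GC_lipschitz _ _ _ d) => //; first exact: gc.
    exact: msl.
  move=> u v; have := lH [tuple of rcons z u] [tuple of rcons z v].
  by rewrite wdist_rcons wxx add0r.
have mean (H : k.+1.-tuple X -> R) : measurable_fun setT H ->
    (forall x y, `|H x - H y| <= wdist d a x y) ->
    (chain q k tt).-integrable setT (EFin \o rcons_mean (q k) H) /\
    forall t : R, (\int[chain q k tt]_x (expR (t * rcons_mean (q k) H x))%:E <=
      (expR (t * Rintegral (chain q k tt) setT (rcons_mean (q k) H) +
       kappa * weight_cost rho k (push_weights rho k a) * t ^+ 2 / 2))%:E)%E.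
  move=> mH lH; apply: IH; first exact: ltnW.
  - move=> i ik; rewrite /push_weights ltr_pwDl ?a0 ?(ltnW ik)//; first exact: ltnW.
    rewrite mulr_ge0 ?(ltW ak)// rho0// subn_gt0 ik/=.
    by rewrite (leq_trans (leq_subr _ _))// ltnW.
  - exact: measurable_rcons_mean.
  - apply: rcons_mean_lipschitz => //; first exact: hW.
    by move=> x y; case: (slice H x y mH lH).
have iF : (chain q k.+1 tt).-integrable setT (EFin \o F).
  have mEF : measurable_fun setT (EFin \o F) by exact/measurable_EFinP.
  apply/integrableP; split=> //.
  rewrite ge0_integral_chain//; last exact: measurableT_comp.
  (* The absolute value obeys the same Lipschitz bound, so its mean is integrable by induction;
     Tonelli then gives the integrability of [F]. *)
  pose H x := `|F x|.
  have mH : measurable_fun setT H by exact: measurableT_comp.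
  have lH x y : `|H x - H y| <= wdist d a x y.
    exact: le_trans (ler_dist_dist _ _) (lF x y).
  have [/integrableP[_ iG] _] := mean H mH lH.
  apply: le_lt_trans iG; rewrite le_eqVlt; apply/orP; left; apply/eqP.
  apply: eq_integral => x _; have [ix _] := slice H x x mH lH.
  rewrite /= ger0_norm; last by apply: Rintegral_ge0 => u _; exact: normr_ge0.
  rewrite /rcons_mean /Rintegral fineK//.
  exact: integrable_fin_num.
split=> // t.
have mexp : measurable_fun setT (fun x => (expR (t * F x))%:E).
  apply/measurable_EFinP; apply: measurableT_comp => //.
  exact: measurable_funM.
rewrite ge0_integral_chain//.
have mG := measurable_rcons_mean _ _ _ _ (q k) _ mF.
have [iG eG] := mean F mF lF.
have -> : Rintegral (chain q k.+1 tt) setT F =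
    Rintegral (chain q k tt) setT (rcons_mean (q k) F).
  rewrite /Rintegral integral_chain// => x.
  by case: (slice F x x mF lF).
(* The cost of the last coordinate does not depend on the history, so [expR c] leaves the outer
   integral. *)
set c := kappa * a k ^+ 2 * t ^+ 2 / 2.
apply: (@le_trans _ _ (\int[chain q k tt]_x
    ((expR c)%:E * (expR (t * rcons_mean (q k) F x))%:E))%E).
  apply: ge0_le_integral_pointwise => x.
    by apply: integral_ge0 => u _; rewrite lee_fin expR_ge0.
  by rewrite -EFinM -expRD addrC; exact: (slice F x x mF lF).2.
rewrite ge0_integralZl//; last first.
- apply/measurable_EFinP; apply: measurableT_comp => //.
  exact: measurable_funM.
apply: (@le_trans _ _ ((expR c)%:E * _)%E).
  by apply: lee_wpmul2l (eG t); rewrite lee_fin expR_ge0.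
rewrite -EFinM -expRD lee_fin ler_expR /= /c le_eqVlt; apply/orP; left; apply/eqP.
by ring.
Qed.

(** * Growth of the sensitivities *)

(** Each averaging multiplies the bound on the weights by [1 + M]. The cost is thus at most a
    geometric sum of ratio [(1 + M) ^+ 2], and [M ^+ 2 <= (1 + M) ^+ 2 - 1] makes it telescope. *)
Lemma weight_cost_bounded (R : realType) (rho : nat -> R) (n : nat) (M : R) :
  0 < M -> (forall j, (0 < j <= n)%N -> 0 <= rho j <= M) ->
  forall k a j, (k <= n)%N -> (forall i, (i < k)%N -> 0 <= a i <= (1 + M) ^+ j) ->
  weight_cost rho k a * M ^+ 2 <= (1 + M) ^+ (2 * (k + j)) - (1 + M) ^+ (2 * j).
Proof.
move=> M0 hrho; elim=> [|k IH] a j kn ha.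
  by rewrite mul0r add0n subrr.
have /andP[ak0 akj] := ha k (ltnSn k).
have {}IH : weight_cost rho k (push_weights rho k a) * M ^+ 2 <=
    (1 + M) ^+ (2 * (k + j.+1)) - (1 + M) ^+ (2 * j.+1).
  apply: IH; first exact: ltnW.
  move=> i ik; have /andP[ai0 aij] := ha i (ltnW ik).
  have /andP[r0 rM] : 0 <= rho (k - i)%N <= M by apply: hrho; lia.
  rewrite /push_weights addr_ge0 ?mulr_ge0//= exprSr mulrDr mulr1.
  by rewrite lerD// ler_pM.
rewrite /= mulrDl addSnnS; apply: (le_trans (lerD (lexx _) IH)).
rewrite addrC -addrA lerD2l.
rewrite [X in _ ^+ X]mulnS exprD.
have : a k ^+ 2 <= (1 + M) ^+ (2 * j) by rewrite mulnC exprM lerXn2r// nnegrE// exprn_ge0//; lra.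
have : 0 <= (1 + M) ^+ (2 * j) by rewrite exprn_ge0//; lra.
move: (_ ^+ (2 * j)) => B B0 aB.
have := ler_wpM2r (sqr_ge0 M) aB; nra.
Qed.

(** The invariant records, for each [i], the window of indices of [rho] met so far. They are
    distinct, so the window sums to at most [Rb], and [S m.+1 = 1 + S m * Rb] bounds the last
    weight. *)
Lemma weight_cost_summable (R : realType) (rho : nat -> R) (n : nat) (Rb : R) :
  (forall j, (0 < j <= n)%N -> 0 <= rho j) ->
  \sum_(1 <= j < n.+1) rho j <= Rb ->
  let S m := \sum_(0 <= l < m) Rb ^+ l in
  forall k a, (k <= n)%N ->
  (forall i, (i < k)%N -> 0 <= a i <= 1 + S (n - k)%N * \sum_(k - i <= j < n - i) rho j) ->
  weight_cost rho k a <= \sum_(n - k + 1 <= m < n.+1) S m ^+ 2.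
Proof.
move=> rho0 hR S.
have R0 : 0 <= Rb.
  apply: le_trans hR; rewrite big_nat_cond sumr_ge0// => j /andP[/andP[j0 jn] _].
  by rewrite rho0// j0.
have S0 m : 0 <= S m by apply: sumr_ge0 => l _; rewrite exprn_ge0.
have SS m : S m.+1 = 1 + S m * Rb.
  rewrite /S big_nat_recl// expr0 mulr_suml; congr (_ + _).
  by apply: eq_bigr => l _; rewrite exprSr.
have Sle m : S m <= S m.+1 by rewrite /S big_nat_recr//= lerDl exprn_ge0.
have part i k : (i < k)%N -> (k <= n)%N -> \sum_(k - i <= j < n - i) rho j <= Rb.
  move=> ik kn; apply: le_trans hR.
  rewrite (@big_cat_nat _ _ _ (n - i)%N 1)/=; [|lia|lia].
  rewrite (@big_cat_nat _ _ _ (k - i)%N 1)/=; [|lia|lia].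
  rewrite addrAC lerDr addr_ge0// big_nat_cond sumr_ge0// => j hj;
    by rewrite rho0//; lia.
elim=> [|k IH] a kn ha.
  by rewrite big_geq//; lia.
have nk : (n - k.+1).+1 = (n - k)%N by lia.
have /andP[ak0 aS] := ha k (ltnSn k).
have akS : a k <= S (n - k)%N.
  by rewrite -nk SS; apply: (le_trans aS); rewrite lerD2l ler_wpM2l// part.
rewrite addn1 nk big_ltn ?ltnS ?leq_subr// /= lerD//.
  by rewrite lerXn2r// nnegrE.
rewrite -addn1; apply: IH; first exact: ltnW.
move=> i ik; have /andP[ai0 aiS] := ha i (ltnW ik).
have r0 : 0 <= rho (k - i)%N by rewrite rho0//; lia.
rewrite /push_weights addr_ge0 ?mulr_ge0//=.
(* The new lowest index [k - i] of the window absorbs [a k * rho (k - i)], as [a k <= S (n - k)];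
   the old terms use that [S] is nondecreasing. *)
rewrite [in leRHS]big_ltn; last by lia.
rewrite mulrDr addrCA addrC lerD//; last by rewrite ler_wpM2r.
apply: (le_trans aiS); rewrite lerD2l subSn; last exact: ltnW.
rewrite ler_wpM2r//; last by rewrite -nk.
by rewrite big_nat_cond sumr_ge0// => j hj; rewrite rho0//; lia.
Qed.

(** * Transfer to the joint law and conclusion *)

Lemma GC_le (R : realType) d0 (Y : measurableType d0) (delta : Y -> Y -> R)
    (mu : {measure set Y -> \bar R}) (kappa kappa' : R) :
  kappa <= kappa' -> GC delta mu kappa -> GC delta mu kappa'.
Proof.
move=> kk gc F mF lF; have [iF eF] := gc F mF lF; split=> // t.
apply: (le_trans (eF t)); rewrite lee_fin ler_expR lerD2l -!mulrA.
by rewrite ler_wpM2r// mulrA divr_ge0 ?sqr_ge0.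
Qed.

Lemma GC_eq_measure (R : realType) d0 (Y : measurableType d0) (delta : Y -> Y -> R)
    (mu nu : {measure set Y -> \bar R}) (kappa : R) :
  (forall A, measurable A -> mu A = nu A) -> GC delta nu kappa -> GC delta mu kappa.
Proof.
move=> munu gc F mF lF; have [/integrableP[mEF iF] eF] := gc F mF lF.
have E f : (\int[mu]_x f x = \int[nu]_x f x)%E.
  by apply: eq_measure_integral => A mA _; exact: munu.
by split=> [|t]; [apply/integrableP; rewrite E|rewrite /Rintegral !E].
Qed.

(** The distance [dist1] is [wdist] with all weights 1, which is where the cost starts. *)
Lemma joint_law_GC (R : realType) d0 (X : measurableType d0)
    (d : X -> X -> R) (n : nat)
    (P1 : probability X R) (p : forall k : nat, R.-pker (k.-tuple X) ~> X)
    (P : probability (n.-tuple X) R) (kappa : R) (rho : nat -> R) :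
  is_metric d -> joint_law P1 p P ->
  (forall j, (0 < j <= n)%N -> 0 <= rho j) ->
  GC d P1 kappa ->
  (forall k, (0 < k < n)%N -> forall x : k.-tuple X, GC d (p k x) kappa) ->
  (forall k, (0 < k < n)%N -> forall x y : k.-tuple X,
     (W1 d (p k x) (p k y) <= (wdist d (fun i => rho (k - i)%N) x y)%:E)%E) ->
  GC (@dist1 R X d n) P (kappa * weight_cost rho n (fun=> 1)).
Proof.
move=> md jl rho0 gc1 gc hW.
apply: (@GC_eq_measure _ _ _ _ _ (chain (law_step P1 p) n tt)).
  by move=> A mA; exact: joint_lawE.
have gcq k : (k < n)%N -> forall x, GC d (law_step P1 p k x) kappa.
  by case: k => [_ x|k kn x]; [exact: gc1|exact: gc].
move=> F mF lF; apply: (chain_concentration _ _ _ d _ n) => //.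
- case=> [_ x y c g c0 _ _|k kn x y c g c0 mg lg].
    (* There is only one empty history, so both sides vanish. *)
    by rewrite (tuple0 x) (tuple0 y) subrr normr0 /wdist big_ord0 mulr0.
  have ig z := (GC_lipschitz _ _ _ _ _ _ _ _ (gcq _ kn z) c0 mg lg).1.
  by apply: W1_lipschitz => //; exact: hW.
- move=> x y; apply: (le_trans (lF x y)); rewrite /wdist /dist1.
  by under [leRHS]eq_bigr do rewrite mul1r.
Qed.

Theorem theorem3p1 (R : realType) (d0 : measure_display) (X : measurableType d0)
  (d : X -> X -> R) (n : nat)
  (P1 : probability X R) (p : forall k : nat, R.-pker (k.-tuple X) ~> X)
  (P : probability (n.-tuple X) R)
  (kappa1 M : R) (rho : nat -> R) :
  is_metric d -> d_complete d -> d_separable d -> d_borel d ->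
  (0 < n)%N ->
  joint_law P1 p P ->
  0 < kappa1 -> 0 < M ->
  (forall j, (1 <= j <= n)%N -> 0 <= rho j <= M) ->
  (* (i) *)
  GC d P1 kappa1 ->
  (forall k, (1 <= k < n)%N -> forall x : k.-tuple X, GC d (p k x) kappa1) ->
  (* (ii) *)
  (forall k, (1 <= k < n)%N -> forall x y : k.-tuple X,
     (W1 d (p k x) (p k y) <=
      (\sum_(i < k) rho (k - i)%N * d (tnth x i) (tnth y i))%:E)%E) ->
  GC (@dist1 R X d n) P (kappa1 * (1 + M) ^+ (2 * n) / M ^+ 2)
  /\ (forall Rb : R, \sum_(1 <= j < n.+1) rho j <= Rb ->
      GC (@dist1 R X d n) P
         (kappa1 * \sum_(1 <= m < n.+1) (\sum_(0 <= k < m) Rb ^+ k) ^+ 2)).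
Proof.
move=> md _ _ _ _ jl k0 M0 hrho gc1 gc hW.
have rho0 j : (0 < j <= n)%N -> 0 <= rho j by move=> /hrho/andP[].
have gcP := joint_law_GC _ _ _ _ _ _ _ _ _ _ md jl rho0 gc1 gc hW.
split=> [|Rb hR]; apply: GC_le gcP.
  rewrite -mulrA ler_pM2l// ler_pdivlMr ?exprn_gt0//.
  have one i : (i < n)%N -> 0 <= (1 : R) <= (1 + M) ^+ 0.
    by rewrite expr0 ler01 lexx.
  (* With [j = 0] the weights 1 are admissible; the subtracted 1 is then dropped. *)
  have := weight_cost_bounded _ _ _ _ M0 hrho n (fun=> 1) 0 (leqnn n) one.
  by rewrite addn0 muln0 expr0 => /le_trans; apply; rewrite gerBl.
rewrite ler_pM2l//.
(* At [k = n] the factor [S 0] is an empty sum, so the invariant only asks for weights between 0 and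
   1. *)
have := weight_cost_summable _ _ _ _ rho0 hR n (fun=> 1) (leqnn n).
rewrite subnn add0n; apply=> i _.
by rewrite big_geq// mul0r addr0 ler01 lexx.
Qed.
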